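(* For every nonnegative integer $n$, the Horadam quaternions satisfy \begin{align*} W_{n+1}W_{n-1}-W_{n}^{2}&=(-q)^{n-1}\left(W_{2}W_{0}-W_{1}^{2}\right),\\ W_{n-1}W_{n+1}-W_{n}^{2}&=(-q)^{n-1}\left(W_{0}W_{2}-W_{1}^{2}\right),\\ W_{n+1}W_{n-1}-W_{n}^{2}&=(-q)^{n-1}\left(U_{2}U_{0}-U_{1}^{2}\right)\left(w_{1}^{2}-pw_{1}w_{0}-qw_{0}^{2}\right),\\ W_{n-1}W_{n+1}-W_{n}^{2}&=(-q)^{n-1}\left(U_{0}U_{2}-U_{1}^{2}\right)\left(w_{1}^{2}-pw_{1}w_{0}-qw_{0}^{2}\right). \end{align*}
   Context: Let $H$ be the real quaternion algebra with basis $1,i,j,k$ and (non-commutative) multiplication determined by $i^2=j^2=k^2=-1$, $ij=-ji=k$, $jk=-kj=i$, $ki=-ik=j$; real scalars commute with all quaternions. Fix real numbers $p,q$ with $q\neq 0$. The Horadam sequence $w_n=w_n(w_0,w_1;p,q)$ has real initial values $w_0,w_1$ and satisfies $w_n=pw_{n-1}+qw_{n-2}$ for $n\ge 2$; it is extended to negative indices by running the recurrence backwards (equivalently $(-q)^n w_{-n}=w_0u_{n+1}-w_1u_n$ for $n\ge 0$). Let $u_n=w_n(0,1;p,q)$ (the $(p,q)$-Fibonacci numbers). The Horadam quaternions are $W_n=w_n+w_{n+1}i+w_{n+2}j+w_{n+3}k$ for all integers $n$, and the $(p,q)$-Fibonacci quaternions are $U_n=u_n+u_{n+1}i+u_{n+2}j+u_{n+3}k$.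 Here $W_n^2=W_nW_n$. *)

(* Defs.v *)
From HB Require Import structures.
From mathcomp Require Import all_boot all_order all_algebra.
From mathcomp Require Import reals ring zify.

Set Implicit Arguments.
Unset Strict Implicit.
Unset Printing Implicit Defensive.

Import Order.TTheory GRing.Theory Num.Theory.
Local Open Scope ring_scope.

Record quaternion (R : Type) : Type :=
  Quaternion { q_re : R; q_i : R; q_j : R; q_k : R }.

Section QuaternionChoice.
Variable R : Type.

Definition tuple_of_quat (x : quaternion R) := (q_re x, q_i x, q_j x, q_k x).
Definition quat_of_tuple (t : R * R * R * R) :=
  let: (a, b, c, d) := t in Quaternion a b c d.

Lemma tuple_of_quatK : cancel tuple_of_quat quat_of_tuple.
Proof. by case. Qed.

End QuaternionChoice.

HB.instance Definition _ (R : eqType) :=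
  Equality.copy (quaternion R) (can_type (@tuple_of_quatK R)).
HB.instance Definition _ (R : choiceType) :=
  Choice.copy (quaternion R) (can_type (@tuple_of_quatK R)).

Section QuaternionAlgebra.
Variable R : comNzRingType.
Implicit Types (x y z : quaternion R) (a b : R).

Definition addq x y :=
  Quaternion (q_re x + q_re y) (q_i x + q_i y) (q_j x + q_j y) (q_k x + q_k y).
Definition oppq x := Quaternion (- q_re x) (- q_i x) (- q_j x) (- q_k x).
Definition zeroq : quaternion R := Quaternion 0 0 0 0.

Lemma addqA : associative addq.
Proof. by move=> x y z; congr Quaternion; apply: addrA. Qed.
Lemma addqC : commutative addq.
Proof. by move=> x y; congr Quaternion; apply: addrC. Qed.
Lemma add0q : left_id zeroq addq.
Proof. by case=> a b c d; congr Quaternion; apply: add0r. Qed.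
Lemma addNq : left_inverse zeroq oppq addq.
Proof. by move=> x; congr Quaternion; apply: addNr. Qed.

HB.instance Definition _ :=
  GRing.isZmodule.Build (quaternion R) addqA addqC add0q addNq.

(* Bilinear extension of i^2 = j^2 = k^2 = -1, ij = -ji = k, jk = -kj = i,
   ki = -ik = j; see the lemmas quat_ii to quat_ik below. *)
Definition mulq x y :=
  Quaternion
    (q_re x * q_re y - q_i x * q_i y - q_j x * q_j y - q_k x * q_k y)
    (q_re x * q_i y + q_i x * q_re y + q_j x * q_k y - q_k x * q_j y)
    (q_re x * q_j y - q_i x * q_k y + q_j x * q_re y + q_k x * q_i y)
    (q_re x * q_k y + q_i x * q_j y - q_j x * q_i y + q_k x * q_re y).
Definition oneq : quaternion R := Quaternion 1 0 0 0.

Lemma mulqA : associative mulq.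
Proof. by move=> x y z; congr Quaternion => /=; ring. Qed.
Lemma mul1q : left_id oneq mulq.
Proof. by case=> a b c d; congr Quaternion => /=; ring. Qed.
Lemma mulq1 : right_id oneq mulq.
Proof. by case=> a b c d; congr Quaternion => /=; ring. Qed.
Lemma mulqDl : left_distributive mulq addq.
Proof. by move=> x y z; congr Quaternion => /=; ring. Qed.
Lemma mulqDr : right_distributive mulq addq.
Proof. by move=> x y z; congr Quaternion => /=; ring. Qed.
Lemma oneq_neq0 : oneq != zeroq.
Proof. by apply/eqP=> -[] /eqP; rewrite oner_eq0. Qed.

HB.instance Definition _ :=
  GRing.Zmodule_isNzRing.Build (quaternion R)
    mulqA mul1q mulq1 mulqDl mulqDr oneq_neq0.

Definition scaleq a x :=
  Quaternion (a * q_re x) (a * q_i x) (a * q_j x) (a * q_k x).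

Lemma scaleqA a b x : scaleq a (scaleq b x) = scaleq (a * b) x.
Proof. by congr Quaternion; apply: mulrA. Qed.
Lemma scale1q : left_id 1 scaleq.
Proof. by case=> a b c d; congr Quaternion; apply: mul1r. Qed.
Lemma scaleqDr : right_distributive scaleq +%R.
Proof. by move=> a x y; congr Quaternion; apply: mulrDr. Qed.
Lemma scaleqDl x : {morph scaleq^~ x : a b / a + b}.
Proof. by move=> a b; congr Quaternion; apply: mulrDl. Qed.

HB.instance Definition _ :=
  GRing.Zmodule_isLmodule.Build R (quaternion R)
    scaleqA scale1q scaleqDr scaleqDl.

Lemma scaleqAl a x y : a *: (x * y) = (a *: x) * y.
Proof. by congr Quaternion => /=; ring. Qed.
HB.instance Definition _ :=
  GRing.Lmodule_isLalgebra.Build R (quaternion R) scaleqAl.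

Lemma scaleqAr a x y : a *: (x * y) = x * (a *: y).
Proof. by congr Quaternion => /=; ring. Qed.
HB.instance Definition _ :=
  GRing.Lalgebra_isAlgebra.Build R (quaternion R) scaleqAr.

Definition quat_i : quaternion R := Quaternion 0 1 0 0.
Definition quat_j : quaternion R := Quaternion 0 0 1 0.
Definition quat_k : quaternion R := Quaternion 0 0 0 1.

Lemma quat_basis a b c d :
  Quaternion a b c d = a%:A + b *: quat_i + c *: quat_j + d *: quat_k.
Proof. by congr Quaternion => /=; ring. Qed.

Lemma quat_ii : quat_i * quat_i = -1.
Proof. by congr Quaternion => /=; ring. Qed.
Lemma quat_jj : quat_j * quat_j = -1.
Proof. by congr Quaternion => /=; ring. Qed.
Lemma quat_kk : quat_k * quat_k = -1.
Proof. by congr Quaternion => /=; ring. Qed.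
Lemma quat_ij : quat_i * quat_j = quat_k.
Proof. by congr Quaternion => /=; ring. Qed.
Lemma quat_ji : quat_j * quat_i = - quat_k.
Proof. by congr Quaternion => /=; ring. Qed.
Lemma quat_jk : quat_j * quat_k = quat_i.
Proof. by congr Quaternion => /=; ring. Qed.
Lemma quat_kj : quat_k * quat_j = - quat_i.
Proof. by congr Quaternion => /=; ring. Qed.
Lemma quat_ki : quat_k * quat_i = quat_j.
Proof. by congr Quaternion => /=; ring. Qed.
Lemma quat_ik : quat_i * quat_k = - quat_j.
Proof. by congr Quaternion => /=; ring. Qed.

End QuaternionAlgebra.

Section Horadam.
Variables (R : realType) (p q : R).

Fixpoint horadam_nat (w0 w1 : R) (n : nat) : R :=
  match n with
  | 0 => w0
  | 1 => w1
  | (m.+1 as m1).+1 => p * horadam_nat w0 w1 m1 + q * horadam_nat w0 w1 m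
  end.

(* horadam_opp w0 w1 n is w_(-n), obtained by solving the recurrence
   w_(m+2) = p w_(m+1) + q w_m for w_m. *)
Fixpoint horadam_opp (w0 w1 : R) (n : nat) : R :=
  match n with
  | 0 => w0
  | 1 => (w1 - p * w0) / q
  | (m.+1 as m1).+1 => (horadam_opp w0 w1 m - p * horadam_opp w0 w1 m1) / q
  end.

Definition horadam (w0 w1 : R) (n : int) : R :=
  match n with
  | Posz m => horadam_nat w0 w1 m
  | Negz m => horadam_opp w0 w1 m.+1
  end.

Definition horadam_quat (w0 w1 : R) (n : int) : quaternion R :=
  let w := horadam w0 w1 in
  (w n)%:A + w (n + 1) *: quat_i R + w (n + 2) *: quat_j R
    + w (n + 3) *: quat_k R.

Definition fib (n : int) : R := horadam 0 1 n.
Definition fib_quat (n : int) : quaternion R := horadam_quat 0 1 n.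

Lemma horadam_rec (w0 w1 : R) (n : int) : q != 0 ->
  horadam w0 w1 n = p * horadam w0 w1 (n - 1) + q * horadam w0 w1 (n - 2).
Proof.
move=> q0; case: n => [[|[|n]]|n].
- by rewrite /=; field.
- by rewrite /=; field.
- have -> : n.+2%:Z - 1 = n.+1%:Z by lia.
  by have -> : n.+2%:Z - 2 = n%:Z by lia.
- have -> : Negz n - 1 = Negz n.+1 by lia.
  have -> : Negz n - 2 = Negz n.+2 by lia.
  have -> (m : nat) : horadam w0 w1 (Negz m) = horadam_opp w0 w1 m.+1 by [].
  rewrite [horadam w0 w1 (Negz n.+2)]/= -/(horadam_opp w0 w1 n.+2).
  by rewrite /=; field.
Qed.

Lemma horadamN (w0 w1 : R) (n : nat) : q != 0 ->
  (- q) ^+ n * horadam w0 w1 (- n%:Z) = w0 * fib n.+1%:Z - w1 * fib n%:Z.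
Proof.
move=> q0.
have -> : horadam w0 w1 (- n%:Z) = horadam_opp w0 w1 n by case: n.
rewrite /fib /=.
suff [] : (- q) ^+ n * horadam_opp w0 w1 n
    = w0 * horadam_nat 0 1 n.+1 - w1 * horadam_nat 0 1 n
  /\ (- q) ^+ n.+1 * horadam_opp w0 w1 n.+1
    = w0 * horadam_nat 0 1 n.+2 - w1 * horadam_nat 0 1 n.+1 by [].
elim: n => [|n [IH1 IH2]].
  by split; rewrite ?expr0 ?expr1 /=; [ring | field].
split=> //.
have -> : horadam_opp w0 w1 n.+2
  = (horadam_opp w0 w1 n - p * horadam_opp w0 w1 n.+1) / q by [].
have E m : horadam_nat 0 1 m.+2
  = p * horadam_nat 0 1 m.+1 + q * horadam_nat 0 1 m by [].
transitivity (q * ((- q) ^+ n * horadam_opp w0 w1 n)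
  + p * ((- q) ^+ n.+1 * horadam_opp w0 w1 n.+1)).
  by rewrite !exprS; field.
by rewrite IH1 IH2 !E; ring.
Qed.

End Horadam.

(* Main.v *)
Require Import Defs.
From mathcomp Require Import all_boot all_order all_algebra.
From mathcomp Require Import reals ring zify.

Import Order.TTheory GRing.Theory Num.Theory.
Local Open Scope ring_scope.

(* Write [w], [w'] for two consecutive terms [w_m], [w_(m+1)].  All later terms
   are linear in them, and expanding shows that [W_(m+2) W_m - W_(m+1)^2] is the
   quadratic form [w'^2 - p w' w - q w^2] times the quaternion
   [U_2 U_0 - U_1^2], which does not depend on the sequence; likewise with the
   factors in the other order.  One step of the recurrence multiplies the
   quadratic form by [-q], so its value at [m = n - 1] is [(-q)^(n-1)] times its
   value at [m = 0]. *)

Section HoradamQuaternion.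
Variables (R : realType) (p q : R).
Hypothesis q_neq0 : q != 0.

Lemma horadamS2 (w0 w1 : R) (m : int) :
  horadam p q w0 w1 (m + 2)
  = p * horadam p q w0 w1 (m + 1) + q * horadam p q w0 w1 m.
Proof. by rewrite horadam_rec // addrK -[in m + 2 - 1]addrA. Qed.

(** For consecutive terms [x], [y], [z] with [z = p y + q x], this is the scalar Cassini expression
    [y^2 - x z]. *)
Definition horadam_form (x y : R) : R := y ^+ 2 - p * y * x - q * x ^+ 2.

Lemma horadam_form_step (x y : R) :
  horadam_form y (p * y + q * x) = - q * horadam_form x y.
Proof. by rewrite /horadam_form; ring. Qed.

Lemma horadam_form_exp (w0 w1 : R) (m : int) :
  horadam_form (horadam p q w0 w1 m) (horadam p q w0 w1 (m + 1))
  = (- q) ^ m * horadam_form w0 w1.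
Proof.
have nq_neq0 : - q != 0 by rewrite oppr_eq0.
pose f m := horadam_form (horadam p q w0 w1 m) (horadam p q w0 w1 (m + 1)).
have fS k : f (k + 1) = - q * f k.
  by rewrite /f -addrA horadamS2 horadam_form_step.
rewrite -/(f m); elim/int_rect: m => [|k IHk|k IHk].
- by rewrite expr0z mul1r.
- by rewrite -addn1 PoszD fS IHk expfzDr // expr1z; ring.
(* Downward step: multiplying by the nonzero [- q] moves the index up from [-(k+1)] to [-k]. *)
- apply: (mulfI nq_neq0); rewrite -fS mulrA -[X in X * _ ^ _]expr1z -expfzDr //.
  have -> : - k.+1%:Z + 1 = - k%:Z by lia.
  by have -> : 1 - k.+1%:Z = - k%:Z by lia.
Qed.

(** Writing the four coordinates through the first two makes each Cassini identity a polynomial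
    identity in [x], [y], [p], [q]. *)
Definition seed_quat (x y : R) : quaternion R :=
  let z := p * y + q * x in Quaternion x y z (p * z + q * y).

Lemma horadam_quatE (w0 w1 : R) (m : int) :
  horadam_quat p q w0 w1 m
  = seed_quat (horadam p q w0 w1 m) (horadam p q w0 w1 (m + 1)).
Proof.
rewrite /horadam_quat -quat_basis /seed_quat -horadamS2.
rewrite (_ : m + 3 = m + 1 + 2) ?horadamS2; last by rewrite -addrA.
by rewrite (_ : m + 1 + 1 = m + 2) ?horadamS2 -?addrA.
Qed.

Lemma fib_quatE :
  [/\ fib_quat p q 0 = seed_quat 0 1, fib_quat p q 1 = seed_quat 1 p
    & fib_quat p q 2 = seed_quat p (p * p + q)].
Proof.
by split; rewrite /fib_quat horadam_quatE /= ?mulr1 ?mulr0 ?addr0.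
Qed.

Lemma seed_quat_cassini (x y : R) :
  let z := p * y + q * x in
  let X := seed_quat x y in let Y := seed_quat y z in
  let Z := seed_quat z (p * z + q * y) in
  let U := fib_quat p q in
  Z * X - Y ^+ 2 = horadam_form x y *: (U 2 * U 0 - U 1 ^+ 2) /\
  X * Z - Y ^+ 2 = horadam_form x y *: (U 0 * U 2 - U 1 ^+ 2).
Proof.
have [U0 U1 U2] := fib_quatE.
rewrite /= U0 U1 U2 /seed_quat /horadam_form !expr2.
by split; congr Quaternion => /=; ring.
Qed.

Lemma horadam_quat_cassini (w0 w1 : R) (m : int) :
  let W := horadam_quat p q w0 w1 in
  let U := fib_quat p q in
  W (m + 2) * W m - W (m + 1) ^+ 2
    = ((- q) ^ m * horadam_form w0 w1) *: (U 2 * U 0 - U 1 ^+ 2) /\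
  W m * W (m + 2) - W (m + 1) ^+ 2
    = ((- q) ^ m * horadam_form w0 w1) *: (U 0 * U 2 - U 1 ^+ 2).
Proof.
rewrite /= -horadam_form_exp !horadam_quatE.
have -> : m + 2 + 1 = m + 1 + 2 by rewrite addrAC.
have -> : m + 1 + 1 = m + 2 by rewrite -addrA.
(* The term at [m + 3] is reduced before the one at [m + 2], which gives the nested shape of
   [seed_quat_cassini]. *)
have -> := horadamS2 w0 w1 (m + 1).
have -> : m + 1 + 1 = m + 2 by rewrite -addrA.
rewrite !horadamS2.
exact: seed_quat_cassini.
Qed.

End HoradamQuaternion.

Theorem theorem2p1 (R : realType) (p q w0 w1 : R) (hq : q != 0) (n : nat) :
  let W := horadam_quat p q w0 w1 in
  let U := fib_quat p q in
  [/\ W (n%:Z + 1) * W (n%:Z - 1) - W n%:Z ^+ 2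
        = (- q) ^ (n%:Z - 1) *: (W 2 * W 0 - W 1 ^+ 2),
      W (n%:Z - 1) * W (n%:Z + 1) - W n%:Z ^+ 2
        = (- q) ^ (n%:Z - 1) *: (W 0 * W 2 - W 1 ^+ 2),
      W (n%:Z + 1) * W (n%:Z - 1) - W n%:Z ^+ 2
        = (- q) ^ (n%:Z - 1) *: (U 2 * U 0 - U 1 ^+ 2)
            * (w1 ^+ 2 - p * w1 * w0 - q * w0 ^+ 2)%:A
    & W (n%:Z - 1) * W (n%:Z + 1) - W n%:Z ^+ 2
        = (- q) ^ (n%:Z - 1) *: (U 0 * U 2 - U 1 ^+ 2)
            * (w1 ^+ 2 - p * w1 * w0 - q * w0 ^+ 2)%:A].
Proof.
move=> W U.
(* For [n = 0] the index is [-1], hence the statement over all integers. *)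
have [] := @horadam_quat_cassini R p q hq w0 w1 (n%:Z - 1).
rewrite -/W -/U subrK (_ : n%:Z - 1 + 2 = n%:Z + 1); last by lia.
(* Index [0] identifies the initial differences of [W] with the form times those of [U]. *)
have [] := @horadam_quat_cassini R p q hq w0 w1 0.
rewrite -/W -/U !add0r expr0z mul1r => E20 E02 En En'.
by rewrite En En' E20 E02 !scalerA !mulr_algr !scalerA
  ![_ * (- q) ^ _]mulrC.
Qed.
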